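(* Let $M$ be a monotone Möbius structure on $X=S^1$ satisfying the Increment Axiom (I). Then the time inequality holds for $M$: for any events $a<b<c$, $$t(a,b)+t(b,c)\le t(a,c),$$ and in the case $t(a,c)>0$ equality holds if and only if $a,b,c$ are events on a common timelike line.
   Context: **Möbius structures.** $X=S^1$. A semi-metric on $X$ is a symmetric function $d:X^2\to\mathbb R\cup\{\infty\}$, positive off the diagonal, zero on it, with at most one infinitely remote point $\omega$, i.e. a point with $d(x,\omega)=\infty$ for some (then, by requirement, for all) $x\ne\omega$. Two semi-metrics are Möbius equivalent if they have the same cross-ratios $\frac{d(x_1,x_3)d(x_2,x_4)}{d(x_1,x_4)d(x_2,x_3)}$ on all 4-tuples of pairwise distinct points; here and in all homogeneous (in)equalities below infinite distances cancel. A Möbius structure $M$ is a Möbius equivalence class of semi-metrics; $|xy|$ denotes the distance in any semi-metric from $M$. The $M$-topology has as subbase all open balls, centered at finite points, of semi-metrics in $M$ having an infinitely remote point. Two disjoint pairs of points of $X$ separate each other if the points of one lie in different components of the complement of the other. $M$ is monotone if (T) the $M$-topology is the usual topology of $S^1$, and (M) whenever $(x,y)$, $(z,u)$ separate each other, $|xy|\,|zu|>\max\{|xz|\,|yu|,|xu|\,|yz|\}$. **Increment Axiom (I).** For all pairwise distinct points $o,\omega,v,\omega',o',u,x\in X$ lying on the circle in this cyclic order (in one of the two directions) such that $|ou|\,|vo'|=|ov|\,|o'u|$ and $|\omega u|\,|v\omega'|=|\omega v|\,|\omega'u|$, $$\frac{|ou|\,|\omega x|}{|ox|\,|\omega u|}>\frac{|\omega'u|\,|o'x|}{|\omega'x|\,|o'u|}.$$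 **Events, timelike lines, time determined by monotone $M$.** $\mathrm{aY}$ is the set of unordered pairs of distinct points of $X$ (events). Two events are in the causal relation if they do not separate each other (events sharing a point do not separate each other). A light line is $p_x=\{(x,x'):x'\ne x\}$. For $e=(z,u)$ the timelike line $h_e$ is the set of events $(x,y)$ with $x,y,z,u$ pairwise distinct and $|xz|\,|yu|=|xu|\,|yz|$. The time $t(a,a')$ is defined for events in the causal relation: $t(a,a')=0$ if $a,a'$ share a point; otherwise there is a unique event $e=(x,y)$ with $a=(z,u),a'=(z',u')\in h_e$, and $t(a,a')=\left|\ln\frac{|xz'|\,|yz|}{|xz|\,|yz'|}\right|$. For events, $a<b<c$ means that $a\ne b\neq c$ and, $b^+,b^-$ being the two closed arcs of $X$ with end points $b$ (suitably labelled), $a\subset b^-$ and $c\subset b^+$. *)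

(* Defs.v *)
From mathcomp Require Import all_boot all_order all_algebra.
From mathcomp Require Import all_classical all_reals all_analysis.

Set Implicit Arguments.
Unset Strict Implicit.
Unset Printing Implicit Defensive.

Import Order.TTheory GRing.Theory Num.Theory.
Import numFieldNormedType.Exports.

Local Open Scope classical_set_scope.
Local Open Scope ring_scope.

Definition circle (R : realType) : set (R * R) :=
  [set p | p.1 ^+ 2 + p.2 ^+ 2 = 1].
Arguments circle R : clear implicits.

(* The library's topology on [set_type A] is the one induced from the
   ambient space, here the plane. *)
Notation S1 R := (set_type (circle R)).

Section Circle.
Variable R : realType.
Local Notation X := (S1 R).

(* Strictly increasing angles within less than one full turn; in particular
   the points of [s] are pairwise distinct. *)
Definition counterclockwise (s : seq X) : Prop :=
  exists t : seq R, [/\ sorted <%R t, last 0 t < head 0 t + 2 * pi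
    & [seq set_val p | p <- s] = [seq (cos a, sin a) | a <- t]].

Definition cyclic_order (s : seq X) : Prop :=
  counterclockwise s \/ counterclockwise (rev s).

(* Unordered pairs of distinct points are represented by two-point sets. *)
Definition event (e : set X) : Prop :=
  exists x y, x <> y /\ e = [set x; y].

Definition separate (a b : set X) : Prop :=
  a `&` b = set0 /\ exists x y, [/\ a x, a y &
    connected_component (~` b) x <> connected_component (~` b) y].

Definition closed_arcs (b : set X) : set (set X) :=
  [set b `|` connected_component (~` b) x | x in ~` b].

Definition before (a b c : set X) : Prop :=
  [/\ a <> b, b <> c & exists bm bp, [/\ closed_arcs b bm, closed_arcs b bp,
    bm <> bp, a `<=` bm & c `<=` bp]].

End Circle.

Section Moebius.
Variable R : realType.
Local Notation X := (S1 R).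
Implicit Types (d : X -> X -> \bar R) (M : set (X -> X -> \bar R)).

Definition infinitely_remote d (w : X) : Prop :=
  forall x, x <> w -> d x w = +oo%E.

Record semi_metric d : Prop := {
  semi_metric_sym : forall x y, d x y = d y x;
  semi_metric_diag : forall x, d x x = 0%E;
  semi_metric_pos : forall x y, x <> y -> (0 < d x y)%E;
  semi_metric_infty : forall x y,
    d x y = +oo%E -> infinitely_remote d x \/ infinitely_remote d y;
  semi_metric_remote_uniq : forall w w',
    infinitely_remote d w -> infinitely_remote d w' -> w = w' }.

(* Infinite distances are replaced by 1. All formulas below are homogeneous:
   a point occurs equally often in the numerator and in the denominator (or on
   both sides), each time paired with a point different from it. Hence this
   replacement amounts to cancelling the infinite distances. *)
Definition dist d (x y : X) : R :=
  if d x y == +oo%E then 1 else fine (d x y).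

Definition cross_ratio d (x1 x2 x3 x4 : X) : R :=
  (dist d x1 x3 * dist d x2 x4) / (dist d x1 x4 * dist d x2 x3).

Definition moebius_equiv d d' : Prop :=
  forall x1 x2 x3 x4, uniq [:: x1; x2; x3; x4] ->
    cross_ratio d x1 x2 x3 x4 = cross_ratio d' x1 x2 x3 x4.

Definition moebius_structure M : Prop :=
  exists2 d0, semi_metric d0 &
    M = [set d | semi_metric d /\ moebius_equiv d0 d].

Definition moebius_balls M : set (set X) :=
  [set B | exists d w x (r : R), [/\ M d, infinitely_remote d w, x <> w, 0 < r
    & B = [set y | (d x y < r%:E)%E]]].

Definition moebius_open M (U : set X) : Prop :=
  exists2 F : set (set X), F `<=` finI_from (moebius_balls M) id &
    U = \bigcup_(V in F) V.

Definition monotone_moebius M : Prop :=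
  (forall U : set X, moebius_open M U <-> open U) /\
  (forall d x y z u, M d -> separate [set x; y] [set z; u] ->
    Num.max (dist d x z * dist d y u) (dist d x u * dist d y z)
      < dist d x y * dist d z u).

Definition increment_axiom M : Prop :=
  forall d o w v w' o' u x, M d ->
    cyclic_order [:: o; w; v; w'; o'; u; x] ->
    dist d o u * dist d v o' = dist d o v * dist d o' u ->
    dist d w u * dist d v w' = dist d w v * dist d w' u ->
    (dist d o u * dist d w x) / (dist d o x * dist d w u)
      > (dist d w' u * dist d o' x) / (dist d w' x * dist d o' u).

Definition timelike_line d (e : set X) : set (set X) :=
  [set a | exists x y z u, [/\ a = [set x; y], e = [set z; u],
    uniq [:: x; y; z; u] &
    dist d x z * dist d y u = dist d x u * dist d y z]].

(* [xget] selects the value determined by the event [[set x; y]] whose timelike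
   line contains [a] and [a']. For a monotone Moebius structure and disjoint
   events in the causal relation, this event exists and is unique, and the
   value does not depend on the choice of [x], [y], [z], [z']. *)
Definition time d (a a' : set X) : R :=
  if a `&` a' != set0 then 0 else
  xget 0 [set t | exists x y z z',
    [/\ timelike_line d [set x; y] a, timelike_line d [set x; y] a',
        a z, a' z' &
        t = `|ln ((dist d x z' * dist d y z) / (dist d x z * dist d y z'))|]].

End Moebius.

(* Main.v *)
(* Write l for the logarithm of the distance, as a function of two angles, and
   attach to disjoint events a, b in the causal relation the potential
     H_ab(s) = l(s,b1) + l(s,b2) - l(s,a1) - l(s,a2).
   If (u,v) is the common perpendicular of a and b, with u behind a and v
   behind b, then t(a,b) = (H_ab(u) - H_ab(v)) / 2, and the Increment Axiom says
   precisely that u is the strict minimum of H_ab on the arc behind a and v its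
   strict maximum on the arc behind b. Thus t(a,b) is the minimum of
   (H_ab(u) - H_ab(v)) / 2, attained only at the common perpendicular. For
   a < b < c one has H_ac = H_ab + H_bc, so evaluating at the common
   perpendicular of a and c gives t(a,c) >= t(a,b) + t(b,c), with equality only
   if it is also perpendicular to b. *)
Require Import Defs.
From mathcomp Require Import all_boot all_order all_algebra.
From mathcomp Require Import all_classical all_reals all_analysis.
From mathcomp Require Import lra ring.

Set Implicit Arguments.
Unset Strict Implicit.
Unset Printing Implicit Defensive.

Import Order.TTheory GRing.Theory Num.Theory.
Import numFieldNormedType.Exports.

Local Open Scope classical_set_scope.
Local Open Scope ring_scope.

(** * Logarithmic distances on the universal cover of the circle *)

(** Knaster-Tarski on a real interval: the supremum of the points with [x <= g x] is fixed. *)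
Lemma monotone_fixpoint (R : realType) (g : R -> R) (a b : R) : a <= b ->
  (forall x, a <= x <= b -> a <= g x <= b) ->
  (forall x y, a <= x -> x <= y -> y <= b -> g x <= g y) ->
  exists2 x, a <= x <= b & g x = x.
Proof.
move=> ab gab gmono; pose S := [set x | a <= x <= b /\ x <= g x].
have Sa : S a.
  by rewrite /S /= lexx ab; have /andP[] : a <= g a <= b by apply: gab; rewrite lexx.
have ubS : ubound S b by move=> x [/andP[]].
have supS : has_sup S by split; [exists a | exists b].
have ac : a <= sup S by apply: sup_upper_bound.
have cb : sup S <= b by apply: sup_le_ub => //; exists a.
have cgc : sup S <= g (sup S).
  apply: sup_le_ub; first by exists a.
  move=> x Sx; have [/andP[ax xb] xgx] := Sx.
  by apply: (le_trans xgx); apply: gmono => //; apply: sup_upper_bound.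
have /andP[agc gcb] : a <= g (sup S) <= b by apply: gab; rewrite ac.
exists (sup S); first by rewrite ac.
apply/eqP; rewrite eq_le cgc andbT; apply: sup_upper_bound => //.
by split; [rewrite agc | apply: gmono].
Qed.

(** The axioms in terms of angles: [logd_cross] is (M), [logd_increment] is (I) for both
    orientations of the circle, and [logd_onto] is a consequence of (T). *)
Record log_distance (R : realType) (T : R) (l : R -> R -> R) : Prop := {
  logd_sym : forall s t, l s t = l t s;
  logd_period : forall s t, l (s + T) t = l s t;
  logd_cross : forall s1 s2 s3 s4, s1 < s2 -> s2 < s3 -> s3 < s4 -> s4 < s1 + T ->
    l s1 s2 + l s3 s4 < l s1 s3 + l s2 s4 /\
    l s1 s4 + l s2 s3 < l s1 s3 + l s2 s4;
  logd_increment : forall o w v w' o' u x,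
    (o < w /\ w < v /\ v < w' /\ w' < o' /\ o' < u /\ u < x /\ x < o + T) \/
    (x < u /\ u < o' /\ o' < w' /\ w' < v /\ v < w /\ w < o /\ o < x + T) ->
    l o u + l v o' = l o v + l o' u -> l w u + l v w' = l w v + l w' u ->
    l w' u + l o' x - l w' x - l o' u < l o u + l w x - l o x - l w u;
  logd_onto : forall p q r, p < q -> q < p + T ->
    exists s, [/\ p < s, s < q & l s p - l s q = r] }.

Section LogDistance.
Variables (R : realType) (T : R) (l : R -> R -> R).
Hypothesis ld : log_distance T l.

(** Logarithmic form of $|up|\,|vq| = |uq|\,|vp|$: for distinct points, each of the events [(u, v)]
    and [(p, q)] lies on the timelike line of the other. *)
Definition perp (u v p q : R) : Prop := l u p + l v q = l u q + l v p.

Definition potential (a1 a2 b1 b2 s : R) : R :=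
  l s b1 + l s b2 - l s a1 - l s a2.

Local Notation sym := (logd_sym ld).

Lemma logd_period_r s t : l s (t + T) = l s t.
Proof. by rewrite sym (logd_period ld) sym. Qed.

Let per := (logd_period ld, logd_period_r).

Lemma perp_sym u v p q : perp u v p q -> perp v u p q.
Proof. by rewrite /perp => ?; lra. Qed.

Lemma perp_swap u v p q : perp u v p q -> perp u v q p.
Proof. by rewrite /perp => ?; lra. Qed.

Lemma perp_shift u v p q : perp (u + T) v p q <-> perp u v p q.
Proof. by rewrite /perp !per. Qed.

Lemma perp_shift_r u v p q : perp u v p (q + T) <-> perp u v p q.
Proof. by rewrite /perp !per. Qed.

(** * Consequences of the inequality (M) *)

Lemma diff_increasing p q s t : p < s -> s < t -> t < q -> q < p + T ->
  l s p - l s q < l t p - l t q.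
Proof.
move=> ps st tq qp; have [+ _] := logd_cross ld ps st tq qp.
by rewrite (sym p s) (sym p t) => ?; lra.
Qed.

Lemma diff_decreasing p q s t : p < q -> q < s -> s < t -> t < p + T ->
  l t p - l t q < l s p - l s q.
Proof.
move=> pq qs st tp.
have pq' : p + T < q + T by lra.
by have := diff_increasing qs st tp pq'; rewrite !per; lra.
Qed.

(** Perpendicularity makes the difference of [diff_increasing] agree at [s] and [t], but that
    difference is injective on the arc. *)
Lemma perp_same_side p q s t : p < s -> p < t -> s < q -> t < q -> q < p + T ->
  s <> t -> ~ perp s t p q.
Proof.
move=> ps pt sq tq qp /eqP st; rewrite /perp => e.
case/orP: (lt_total st) => lt_st.
- by have := diff_increasing ps lt_st tq qp; lra.
- by have := diff_increasing pt lt_st sq qp; lra.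
Qed.

(** The gap splits into a part for [a1], [b1] and a part for [a2], [b2]; each is positive by (M)
    unless its two ends coincide. *)
Lemma potential_gt a1 a2 b1 b2 u v :
  b1 <= a1 -> a2 <= b2 -> b2 < b1 + T -> a1 <> b1 \/ a2 <> b2 ->
  a1 < u -> u < a2 -> b2 < v -> v < b1 + T ->
  potential a1 a2 b1 b2 v < potential a1 a2 b1 b2 u.
Proof.
move=> b1a1 a2b2 b2b1 ne a1u ua2 b2v vb1; rewrite /potential.
have h1 : a1 <> b1 -> l u a1 + l v b1 < l u b1 + l v a1.
  move=> /eqP; rewrite neq_lt ltNge b1a1 /= => lt1.
  have [_] := @logd_cross _ _ _ ld b1 a1 u v ltac:(lra) ltac:(lra) ltac:(lra) ltac:(lra).
  by rewrite (sym b1) (sym a1) (sym b1 u) (sym a1 v); lra.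
have h2 : a2 <> b2 -> l u a2 + l v b2 < l u b2 + l v a2.
  move=> /eqP; rewrite neq_lt [b2 < a2]ltNge a2b2 orbF => lt2.
  have [+ _] := @logd_cross _ _ _ ld u a2 b2 v ltac:(lra) ltac:(lra) ltac:(lra) ltac:(lra).
  by rewrite (sym b2 v) (sym a2 v); lra.
have [e1|/eqP/h1 {}h1] := eqVneq a1 b1; have [e2|/eqP/h2 {}h2] := eqVneq a2 b2.
- by case: ne.
- by rewrite e1; lra.
- by rewrite e2; lra.
- by lra.
Qed.

(** * Extrema of the potential at a common perpendicular *)

(** This is (I) after taking logarithms, with [a] as [(o, o')] and [b] as [(w, w')]. There [x] lies
    between [u] and [o], so [o] is the end of [a] on the side of [x], and the two sides of [u] need
    the two orientations. *)
Lemma potential_min a1 a2 b1 b2 u v x :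
  b1 < a1 -> a2 < b2 -> b2 < b1 + T ->
  a1 < u -> u < a2 -> b2 < v -> v < b1 + T ->
  perp u v a1 a2 -> perp u v b1 b2 ->
  a1 < x -> x < a2 -> x <> u ->
  potential a1 a2 b1 b2 u < potential a1 a2 b1 b2 x.
Proof.
move=> b1a1 a2b2 b2b1 a1u ua2 b2v vb1 pa pb a1x xa2 /eqP xu.
move: pa pb; rewrite /perp /potential => pa pb.
case/orP: (lt_total xu) => lt_xu.
- have := @logd_increment _ _ _ ld (a1 + T) (b1 + T) v b2 a2 u x.
  rewrite !per (sym a2 u) (sym b2 u) (sym a1 u) (sym a1 v).
  rewrite (sym b1 u) (sym b1 v) (sym a2 x) (sym b1 x) (sym b2 x) (sym a1 x).
  move=> /(_ ltac:(right; repeat split; lra) ltac:(lra) ltac:(lra)); lra.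
- have := @logd_increment _ _ _ ld a2 b2 v (b1 + T) (a1 + T) (u + T) (x + T).
  rewrite !per (sym a2 u) (sym a2 v) (sym a1 u) (sym b2 u) (sym b2 v) (sym b1 u).
  rewrite (sym a2 x) (sym b2 x) (sym b1 x) (sym a1 x).
  move=> /(_ ltac:(left; repeat split; lra) ltac:(lra) ltac:(lra)); lra.
Qed.

(* Exchanging the two nested arcs changes the sign of the potential. *)
Lemma potential_max a1 a2 b1 b2 u v x :
  b1 < a1 -> a2 < b2 -> b2 < b1 + T ->
  a1 < u -> u < a2 -> b2 < v -> v < b1 + T ->
  perp u v a1 a2 -> perp u v b1 b2 ->
  b2 < x -> x < b1 + T -> x <> v ->
  potential a1 a2 b1 b2 x < potential a1 a2 b1 b2 v.
Proof.
move=> b1a1 a2b2 b2b1 a1u ua2 b2v vb1 pa pb b2x xb1 xv.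
have pa' : perp v (u + T) a2 (a1 + T) by move: pa; rewrite /perp !per; lra.
have pb' : perp v (u + T) b2 (b1 + T) by move: pb; rewrite /perp !per; lra.
have := @potential_min b2 (b1 + T) a2 (a1 + T) v (u + T) x ltac:(lra) ltac:(lra)
  ltac:(lra) ltac:(lra) ltac:(lra) ltac:(lra) ltac:(lra) pb' pa' b2x xb1 xv.
by rewrite /potential !per; lra.
Qed.

Lemma potential_gap_min a1 a2 b1 b2 u0 v0 u v :
  b1 < a1 -> a2 < b2 -> b2 < b1 + T ->
  a1 < u0 -> u0 < a2 -> b2 < v0 -> v0 < b1 + T ->
  perp u0 v0 a1 a2 -> perp u0 v0 b1 b2 ->
  a1 < u -> u < a2 -> b2 < v -> v < b1 + T ->
  let gap x y := potential a1 a2 b1 b2 x - potential a1 a2 b1 b2 y in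
  gap u0 v0 <= gap u v /\ (gap u v <= gap u0 v0 -> u = u0 /\ v = v0).
Proof.
move=> b1a1 a2b2 b2b1 a1u0 u0a2 b2v0 v0b1 pa pb a1u ua2 b2v vb1 /=.
have := @potential_min a1 a2 b1 b2 u0 v0 u b1a1 a2b2 b2b1 a1u0 u0a2 b2v0 v0b1 pa pb.
have := @potential_max a1 a2 b1 b2 u0 v0 v b1a1 a2b2 b2b1 a1u0 u0a2 b2v0 v0b1 pa pb.
move=> /(_ b2v vb1) hv /(_ a1u ua2) hu.
have [eu|/eqP/hu {}hu] := eqVneq u u0; have [ev|/eqP/hv {}hv] := eqVneq v v0.
- by rewrite eu ev.
- by rewrite eu; split=> [|?]; lra.
- by rewrite ev; split=> [|?]; lra.
- by split=> [|?]; lra.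
Qed.

(** * Position and existence of common perpendiculars *)

(** By [perp_same_side] for [b], exactly one of [x], [y] lies behind [b]. The other one lies between
    [a1] and [a2], since otherwise both would be on the outer side of [a]. *)
Lemma perp_localized a1 a2 b1 b2 x y :
  b1 < a1 -> a1 < a2 -> a2 < b2 -> b2 < b1 + T ->
  b1 < x -> x < b1 + T -> x <> a1 -> x <> a2 -> x <> b2 ->
  b1 < y -> y < b1 + T -> y <> a1 -> y <> a2 -> y <> b2 -> x <> y ->
  perp x y a1 a2 -> perp x y b1 b2 ->
  [/\ a1 < x, x < a2, b2 < y & y < b1 + T] \/
  [/\ a1 < y, y < a2, b2 < x & x < b1 + T].
Proof.
move=> b1a1 a1a2 a2b2 b2b1 b1x xb1 /eqP xa1 /eqP xa2 /eqP xb2.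
move=> b1y yb1 /eqP ya1 /eqP ya2 /eqP yb2 xy pa pb.
have outside s t : s < b2 -> b1 < s -> s != a1 -> s != a2 ->
    b2 < t -> t < b1 + T -> s <> t -> perp s t a1 a2 -> a1 < s /\ s < a2.
  move=> sb2 b1s sa1 sa2 b2t tb1 st pst.
  case/orP: (lt_total sa1) => s_a1.
    case: (@perp_same_side a2 (a1 + T) (s + T) t) => //; try lra.
    by apply/perp_shift/perp_shift_r/perp_swap.
  split=> //; rewrite ltNge le_eqVlt eq_sym (negbTE sa2) /=; apply/negP => a2s.
  case: (@perp_same_side a2 (a1 + T) s t) => //; try lra.
  by apply/perp_shift_r/perp_swap.
case/orP: (lt_total xb2) => x_b2; case/orP: (lt_total yb2) => y_b2.
- by case: (@perp_same_side b1 b2 x y).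
- by left; have [] := outside x y.
- by right; have [] := outside y x y_b2 => //; [by move=> e; apply: xy|exact: perp_sym].
- case: (@perp_same_side b2 (b1 + T) x y) => //; first lra.
  by apply/perp_shift_r/perp_swap.
Qed.

(* Each of the two conditions defines an order reversing map between the arcs
   (a1, a2) and [b2, b1 + T]; a fixed point of the composition is the end of a
   common perpendicular. The fixed point exists by monotonicity alone, so the
   continuity of these maps is not needed. *)
Lemma perp_exists a1 a2 b1 b2 :
  b1 < a1 -> a1 < a2 -> a2 < b2 -> b2 < b1 + T ->
  exists u v, [/\ a1 < u, u < a2, b2 < v, v < b1 + T &
    perp u v a1 a2 /\ perp u v b1 b2].
Proof.
move=> b1a1 a1a2 a2b2 b2b1.
(* [rel v w] passes from [v] to its harmonic partner [s] with respect to [a], then from [s] to its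
   partner [w] with respect to [b]. *)
pose rel v w := exists s, [/\ a1 < s, s < a2, l s a1 - l s a2 = l v a1 - l v a2 &
  [/\ b2 < w, w < b1 + T & l w b1 - l w b2 = l s b1 - l s b2]].
have /choice[g grel] : forall v, exists w, rel v w.
  move=> v.
  have [s [a1s sa2 es]] := logd_onto ld (l v a1 - l v a2) a1a2 ltac:(lra).
  have [w [b2w wb1 ew]] :=
    @logd_onto _ _ _ ld b2 (b1 + T) (l s b2 - l s b1) ltac:(lra) ltac:(lra).
  by exists w, s; split=> //; split=> //; move: ew; rewrite per; lra.
have gb v : b2 < g v /\ g v < b1 + T by have [s [_ _ _ []]] := grel v.
have gmono x y : b2 <= x -> x <= y -> y <= b1 + T -> g x <= g y.
  move=> b2x; rewrite le_eqVlt => /orP[/eqP-> //|xy] yb1.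
  have [s [a1s sa2 es [b2gx gxb1 egx]]] := grel x.
  have [t [a1t ta2 et [b2gy gyb1 egy]]] := grel y.
  have dec := @diff_decreasing a1 a2 x y ltac:(lra) ltac:(lra) xy ltac:(lra).
  (* Through [a], [x < y] gives [t < s]; through [b], [g y < g x] would give [s < t]. *)
  rewrite leNgt; apply/negP => gyx.
  have := @diff_decreasing b1 b2 (g y) (g x) ltac:(lra) ltac:(lra) gyx ltac:(lra).
  rewrite egx egy => st.
  have ts : t < s.
    rewrite ltNge le_eqVlt; apply/negP => /orP[/eqP e|ts].
      by move: es; rewrite e et => ?; lra.
    by have := @diff_increasing a1 a2 s t ltac:(lra) ts ltac:(lra) ltac:(lra); lra.
  by have := @diff_increasing b1 b2 t s ltac:(lra) ts ltac:(lra) ltac:(lra); lra.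
have gin x : b2 <= x <= b1 + T -> b2 <= g x <= b1 + T.
  by move=> _; have [/ltW-> /ltW->] := gb x.
have [v _ gv] := @monotone_fixpoint _ g b2 (b1 + T) ltac:(lra) gin gmono.
have [s [a1s sa2 es [b2gv gvb1 egv]]] := grel v.
exists s, v; rewrite -{1 2}gv; split=> //; rewrite /perp.
by split; [|move: egv; rewrite gv]; lra.
Qed.

(** The left side is the logarithm of the ratio defining the time. Perpendicularity makes it the
    same for all four choices of [p] and [q], and the choices [a1, b1] and [a2, b2] add up to the
    difference of potentials. *)
Lemma perp_value a1 a2 b1 b2 u v p q :
  perp u v a1 a2 -> perp u v b1 b2 ->
  p = a1 \/ p = a2 -> q = b1 \/ q = b2 ->
  l u q + l v p - l u p - l v q =
  (potential a1 a2 b1 b2 u - potential a1 a2 b1 b2 v) / 2.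
Proof. by rewrite /perp /potential => pa pb [->|->] [->|->]; lra. Qed.

End LogDistance.

(** * Angles and arcs *)

Section CirclePoint.
Variable R : realType.
Local Notation X := (S1 R).
Implicit Types (p q s t : R) (x y : X).

Definition circle_point s : X :=
  SigSub (mem_set (cos2Dsin2 s : circle R (cos s, sin s))).

Lemma circle_pointE s : set_val (circle_point s) = (cos s, sin s).
Proof. by []. Qed.

Lemma set_val_circle_inj x y : set_val x = set_val y -> x = y.
Proof. by rewrite !set_valE; exact: val_inj. Qed.

Lemma circle_point_continuous : continuous circle_point.
Proof.
apply: continuous_comp_initial => s.
rewrite (_ : _ \o _ = fun t => (cos t, sin t)) //.
exact: (cvg_pair (@continuous_cos R s) (@continuous_sin R s)).
Qed.

Lemma circle_pointD2pi s : circle_point (s + 2 * pi) = circle_point s.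
Proof.
by apply: set_val_circle_inj; rewrite !circle_pointE mulr_natl cosD2pi sinD2pi.
Qed.

Lemma circle_pointDint s (k : int) :
  circle_point (s + k%:~R * (2 * pi)) = circle_point s.
Proof.
have nat_case (n : nat) t : circle_point (t + n%:R * (2 * pi)) = circle_point t.
  elim: n => [|n IHn]; first by rewrite mul0r addr0.
  by rewrite -natr1 mulrDl mul1r addrA circle_pointD2pi.
case: k => n; first exact: nat_case.
by rewrite -(nat_case n.+1) NegzE mulrNz mulNr subrK.
Qed.

Lemma circle_point_neq s t : s < t -> t < s + 2 * pi ->
  circle_point s <> circle_point t.
Proof.
move=> st ts /(congr1 set_val); rewrite !circle_pointE => -[ec es].
have {ec es} : cos (t - s) = 1 by rewrite cosB -ec -es -!expr2 cos2Dsin2.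
have [le_pi|gt_pi] := lerP (t - s) pi.
  rewrite -(@cos0 R) => /cos_inj; rewrite !in_itv /= lexx pi_ge0 le_pi subr_ge0 (ltW st).
  by move=> /(_ erefl erefl) /subr0_eq e; rewrite e ltxx in st.
rewrite -(@cos0 R) -cosN -cosD2pi -mulr_natl => /cos_inj.
rewrite !in_itv /= lexx pi_ge0.
have h1 : 0 <= - (t - s) + 2 * pi by lra.
have h2 : - (t - s) + 2 * pi <= pi by lra.
by rewrite h1 h2 => /(_ erefl erefl) e; lra.
Qed.

Lemma circle_point_surj x p :
  exists s, [/\ p <= s, s < p + 2 * pi & x = circle_point s].
Proof.
have [s0 xs0] : exists s, x = circle_point s.
  have := set_valP x; rewrite -set_valE /circle /=.
  case exy: (set_val x) => [c d] /= cd.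
  have c1 : -1 <= c <= 1 by apply/andP; split; nra.
  have sd : sin (acos c) = `|d| by rewrite sin_acos // -cd addrC addKr sqrtr_sqr.
  have [d0|d0] := leP 0 d; [exists (acos c)|exists (- acos c)];
    apply: set_val_circle_inj; rewrite exy circle_pointE ?cosN ?sinN acosK ?in_itv //= sd.
    by rewrite ger0_norm.
  by rewrite ltr0_norm // opprK.
have pi2 : 0 < 2 * pi :> R by rewrite mulr_gt0 // pi_gt0.
exists (s0 + (- Num.floor ((s0 - p) / (2 * pi)))%:~R * (2 * pi)).
have /andP[] := floor_itv ((s0 - p) / (2 * pi)).
rewrite ler_pdivlMr // ltr_pdivrMr // intrD mulr1z => h1 h2.
by split; [rewrite mulrNz; lra | rewrite mulrNz; lra | rewrite circle_pointDint].
Qed.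

(** * Arcs as components of the complement of two points *)

(** The affine function of the plane vanishing on the line through the points at angles [p] and [q];
    its sign tells the two open arcs apart. *)
Definition chord p q x : R :=
  (set_val x).1 * cos ((p + q) / 2) + (set_val x).2 * sin ((p + q) / 2)
  - cos ((q - p) / 2).

Lemma chordE p q s :
  chord p q (circle_point s) = cos (s - (p + q) / 2) - cos ((q - p) / 2).
Proof. by rewrite /chord circle_pointE /= cosB. Qed.

Lemma chord_continuous p q : continuous (chord p q).
Proof.
move=> x; have sv : {for x, continuous (@set_val _ (circle R))}.
  exact: initial_continuous.
have cst1 k : {for x, continuous (fun _ : X => k : R)} by exact: cst_continuous.
have c1 : {for x, continuous (fun y : X => (set_val y).1)}.
  by apply: continuous_comp; [exact: sv | exact: cvg_fst].
have c2 : {for x, continuous (fun y : X => (set_val y).2)}.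
  by apply: continuous_comp; [exact: sv | exact: cvg_snd].
exact: (continuousB (continuousD (continuousM c1 (cst1 _)) (continuousM c2 (cst1 _)))
  (cst1 _)).
Qed.

Lemma chord_gt0 p q s : p < s -> s < q -> q < p + 2 * pi ->
  0 < chord p q (circle_point s).
Proof.
move=> ps sq qp; rewrite chordE subr_gt0 -(cos_norm (s - _)).
have h1 : `|s - (p + q) / 2| < (q - p) / 2 by rewrite ltr_norml; apply/andP; split; lra.
by rewrite ltr_cos // in_itv /= ?normr_ge0 /=; lra.
Qed.

Lemma chord_lt0 p q s : p < q -> q < s -> s < p + 2 * pi ->
  chord p q (circle_point s) < 0.
Proof.
move=> pq qs sp; rewrite chordE subr_lt0.
(* Measured from the antipode of the midpoint of the arc, the angle is less than [pi - (q - p) / 2]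
   in absolute value. *)
have -> : cos (s - (p + q) / 2) = cos (`|s - (p + q) / 2 - pi| - pi).
  rewrite -[RHS]opprK -cosDpi subrK cos_norm.
  by rewrite -[in LHS](subrK pi (s - _)) cosDpi.
rewrite -(cosN (_ - pi)) opprB.
set m := `|_|; have hm : m < pi - (q - p) / 2 by rewrite ltr_norml; apply/andP; split; lra.
have m0 : 0 <= m by exact: normr_ge0.
by rewrite ltr_cos ?in_itv /=; [lra | apply/andP; split; lra..].
Qed.

Lemma chord_neq0 p q x : p < q -> q < p + 2 * pi ->
  ~ [set circle_point p; circle_point q] x -> chord p q x != 0.
Proof.
move=> pq qp nx; have [s [ps sp xs]] := circle_point_surj x p; move: nx; rewrite xs => nx.
have [sp'|sp'] := eqVneq s p; first by case: nx; left; rewrite sp'.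
have [sq'|sq'] := eqVneq s q; first by case: nx; right; rewrite sq'.
have {sp' }ps : p < s by rewrite lt_neqAle eq_sym sp'.
case/orP: (lt_total sq') => lt_sq.
- by rewrite gt_eqF // chord_gt0.
- by rewrite lt_eqF // chord_lt0.
Qed.

Lemma connected_chord p q (C : set X) x y : p < q -> q < p + 2 * pi ->
  connected C -> C `<=` ~` [set circle_point p; circle_point q] ->
  C x -> C y -> 0 < chord p q x -> 0 < chord p q y.
Proof.
move=> pq qp Cconn Csub Cx Cy x0.
have y_neq0 := chord_neq0 pq qp (Csub _ Cy).
rewrite ltNge le_eqVlt (negbTE y_neq0) /=; apply/negP => y0.
have : connected (chord p q @` C).
  apply: connected_continuous_connected => //.
  exact/continuous_subspaceT/chord_continuous.
move=> /connected_intervalP /(_ (chord p q y) (chord p q x)).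
case/(_ _ _ 0); [by exists y | by exists x | by rewrite !ltW|].
by move=> z Cz z0; have := chord_neq0 pq qp (Csub _ Cz); rewrite z0 eqxx.
Qed.

(** A connected set avoiding the two points keeps the sign of [chord], hence stays in the arc;
    conversely the arc is a continuous image of an interval. *)
Lemma arc_component p q s : p < s -> s < q -> q < p + 2 * pi ->
  connected_component (~` [set circle_point p; circle_point q]) (circle_point s)
  = circle_point @` [set t | p < t < q].
Proof.
move=> ps sq qp; apply/seteqP; split=> [x [C [Cs Csub Cconn] Cx]|].
  have := @connected_chord p q C _ x ltac:(lra) qp Cconn Csub Cs Cx (chord_gt0 ps sq qp).
  have [t [pt tp xt]] := circle_point_surj x p; rewrite xt => cp0.
  have nx := Csub _ Cx.
  have tp' : t != p by apply/eqP => e; apply: nx; left; rewrite xt e.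
  have tq' : t != q by apply/eqP => e; apply: nx; right; rewrite xt e.
  exists t => //=; apply/andP; split; first by rewrite lt_neqAle eq_sym tp'.
  rewrite ltNge le_eqVlt eq_sym (negbTE tq') /=; apply/negP => qt.
  by have := chord_lt0 (lt_trans ps sq) qt tp; lra.
apply: connected_component_max; first by exists s => //=; rewrite ps.
  move=> _ [t /andP[pt tq] <-] [] /=.
    by apply/nesym/circle_point_neq => //; lra.
  by apply: circle_point_neq => //; lra.
apply: connected_continuous_connected; last exact/continuous_subspaceT/circle_point_continuous.
by apply/connected_intervalP => u v /= /andP[pu uq] /andP[pv vq] z /andP[uz zv]; apply/andP; split; lra.
Qed.

Lemma closed_arc_of p q s : p < s -> s < q -> q < p + 2 * pi ->
  [set circle_point p; circle_point q] `|`
  connected_component (~` [set circle_point p; circle_point q]) (circle_point s)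
  = circle_point @` [set t | p <= t <= q].
Proof.
move=> ps sq qp; rewrite arc_component //; apply/seteqP; split.
  move=> x [[->|->]|[t /= /andP[pt tq] <-]].
  - by exists p => //=; lra.
  - by exists q => //=; lra.
  - by exists t => //=; lra.
move=> x [t /= /andP[]]; rewrite le_eqVlt => /orP[/eqP->|pt].
  by move=> _ <-; left; left.
rewrite le_eqVlt => /orP[/eqP->|tq] <-; first by left; right.
by right; exists t => //=; rewrite pt.
Qed.

(** * Lifting ordered events to angles *)

Lemma circle_pair_rot p q :
  [set circle_point p; circle_point q] =
  [set circle_point q; circle_point (p + 2 * pi)].
Proof. by rewrite circle_pointD2pi setUC. Qed.

Lemma closed_arcsP p q (B : set X) : p < q -> q < p + 2 * pi ->
  closed_arcs [set circle_point p; circle_point q] B ->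
  B = circle_point @` [set t | p <= t <= q] \/
  B = circle_point @` [set t | q <= t <= p + 2 * pi].
Proof.
move=> pq qp [x nx <-]; have [s [ps sp xs]] := circle_point_surj x p; rewrite xs.
have sp' : s != p by apply/eqP => e; apply: nx; left; rewrite xs e.
have sq' : s != q by apply/eqP => e; apply: nx; right; rewrite xs e.
have {sp'}ps : p < s by rewrite lt_neqAle eq_sym sp'.
case/orP: (lt_total sq') => lt_sq; first by left; rewrite closed_arc_of.
by right; rewrite circle_pair_rot closed_arc_of //; lra.
Qed.

Lemma circle_point_separate p q s t : p < s -> s < q -> q < t -> t < p + 2 * pi ->
  separate [set circle_point p; circle_point q] [set circle_point s; circle_point t].
Proof.
move=> ps sq qt tp.
have ns : circle_point p <> circle_point s by apply: circle_point_neq; lra.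
have nt : circle_point p <> circle_point t by apply: circle_point_neq; lra.
have ns' : circle_point s <> circle_point q by apply: circle_point_neq; lra.
have nt' : circle_point q <> circle_point t by apply: circle_point_neq; lra.
split.
  by rewrite -subset0 => x [[]-> []] // /esym.
exists (circle_point q), (circle_point p); split; [by right | by left|].
move=> e; have : connected_component (~` [set circle_point s; circle_point t])
    (circle_point q) (circle_point p).
  by rewrite e; apply: connected_component_refl => -[].
rewrite arc_component //; last by lra.
move=> [u /= /andP[su ut] /esym]; apply: circle_point_neq; lra.
Qed.

Lemma pair_in_arc (a : set X) p q : event a ->
  a `<=` circle_point @` [set t | p <= t <= q] ->
  exists s t, [/\ p <= s, s < t, t <= q & a = [set circle_point s; circle_point t]].
Proof.
move=> [x [y [xy ->]]] sub.
have [s /= /andP[ps sq] xs] : (circle_point @` [set t | p <= t <= q]) x by apply: sub; left.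
have [t /= /andP[pt tq] yt] : (circle_point @` [set t | p <= t <= q]) y by apply: sub; right.
have /eqP st : s <> t by move=> e; apply: xy; rewrite -xs -yt e.
rewrite -xs -yt; case/orP: (lt_total st) => lt_st.
- by exists s, t.
- by exists t, s; split=> //; rewrite setUC.
Qed.

Lemma arc_shift p q : circle_point @` [set t | p + 2 * pi <= t <= q + 2 * pi] =
  circle_point @` [set t | p <= t <= q].
Proof.
apply/seteqP; split=> _ [t /= /andP[pt tq] <-].
  exists (t - 2 * pi); first by apply/andP; split; lra.
  by rewrite -circle_pointD2pi subrK.
exists (t + 2 * pi); first by apply/andP; split; lra.
by rewrite circle_pointD2pi.
Qed.

(** The angle [b1] is the start of the arc containing [a]; if this is the second arc of the lift
    [p < q] of [b], the lift is replaced by [q], [p + 2 * pi]. *)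
Lemma before_angles (a b c : set X) : event a -> event b -> event c ->
  before a b c -> exists b1 a1 a2 b2 c1 c2,
  [/\ [/\ b1 <= a1, a1 < a2 & a2 <= b2], [/\ b2 <= c1, c1 < c2 & c2 <= b1 + 2 * pi] &
   [/\ a = [set circle_point a1; circle_point a2],
       b = [set circle_point b1; circle_point b2] &
       c = [set circle_point c1; circle_point c2]]].
Proof.
move=> ea [x [y [xy ->]]] ec [_ _ [bm [bp [arcm arcp mp am cp]]]].
have [p [_ _ xp]] := circle_point_surj x 0.
have [q [pq qp yq]] := circle_point_surj y p.
have {}pq : p < q.
  by rewrite lt_neqAle pq andbT; apply/eqP => e; apply: xy; rewrite xp yq e.
move: arcm arcp; rewrite xp yq => /(closed_arcsP pq qp) arcm /(closed_arcsP pq qp) arcp.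
suff [b1 [b2 [eb ambm cpbp]]] : exists b1 b2,
    [/\ [set circle_point p; circle_point q] = [set circle_point b1; circle_point b2],
      a `<=` circle_point @` [set t | b1 <= t <= b2] &
      c `<=` circle_point @` [set t | b2 <= t <= b1 + 2 * pi]].
  have [a1 [a2 [? ? ? ?]]] := pair_in_arc ea ambm.
  have [c1 [c2 [? ? ? ?]]] := pair_in_arc ec cpbp.
  by exists b1, a1, a2, b2, c1, c2; rewrite eb.
case: arcm arcp => em [] ep; rewrite em in mp am; rewrite ep in mp cp => //.
  by exists p, q.
by exists q, (p + 2 * pi); rewrite -circle_pair_rot arc_shift.
Qed.

Lemma counterclockwise_points (s : seq R) : sorted <%R s ->
  last 0 s < head 0 s + 2 * pi -> counterclockwise (map circle_point s).
Proof. by move=> ss ls; exists s; split=> //; rewrite -map_comp. Qed.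

End CirclePoint.

(** * Monotone Moebius structures *)

Section SemiMetric.
Variable R : realType.
Local Notation X := (S1 R).
Implicit Types (d : X -> X -> \bar R) (x y w : X).

Lemma dist_sym d x y : semi_metric d -> dist d x y = dist d y x.
Proof. by move=> sd; rewrite /dist (semi_metric_sym sd). Qed.

Lemma dist_gt0 d x y : semi_metric d -> x <> y -> 0 < dist d x y.
Proof.
move=> sd xy; rewrite /dist; case: ifPn => // nfin.
by apply: fine_gt0; rewrite (semi_metric_pos sd xy) ltey.
Qed.

Lemma third_point x y : exists2 z : X, z <> x & z <> y.
Proof.
have pi0 := pi_gt0 R.
pose c (k : R) := circle_point (k * (pi / 2)).
have c01 : c 0 <> c 1 by apply: circle_point_neq; lra.
have c02 : c 0 <> c 2 by apply: circle_point_neq; lra.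
have c12 : c 1 <> c 2 by apply: circle_point_neq; lra.
have [e0|] := pselect (c 0 = x \/ c 0 = y); last by exists (c 0); tauto.
have [e1|] := pselect (c 1 = x \/ c 1 = y); last by exists (c 1); tauto.
by exists (c 2) => e2; case: e0 => e0; case: e1 => e1; congruence.
Qed.

(** * Metric inversions *)

(** Metric inversion, sending [w] to infinity. Since [dist] replaces infinite distances by 1, the
    formula also covers a [d] with its own infinitely remote point. *)
Definition inversion d w x y : \bar R :=
  if x == y then 0%E else if (x == w) || (y == w) then +oo%E
  else (dist d x y / (dist d x w * dist d y w))%:E.

Lemma inversion_fin d w x y : x <> y -> x <> w -> y <> w ->
  inversion d w x y = (dist d x y / (dist d x w * dist d y w))%:E.
Proof. by rewrite /inversion => /eqP/negbTE-> /eqP/negbTE-> /eqP/negbTE->. Qed.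

Lemma inversion_remote d w : infinitely_remote (inversion d w) w.
Proof. by move=> x /eqP/negbTE xw; rewrite /inversion xw eqxx. Qed.

Lemma inversion_semi_metric d w : semi_metric d -> semi_metric (inversion d w).
Proof.
move=> sd; have remoteP w' : infinitely_remote (inversion d w) w' -> w' = w.
  move=> rw'; apply: contrapT => w'w; have [z zw zw'] := third_point w w'.
  by have := rw' _ zw'; rewrite inversion_fin.
split.
- move=> x y; rewrite /inversion eq_sym (orbC (x == w)) (dist_sym x y sd).
  by rewrite (mulrC (dist d x w)).
- by move=> x; rewrite /inversion eqxx.
- move=> x y /eqP xy; rewrite /inversion (negbTE xy).
  case: ifPn => // /norP[/eqP xw /eqP yw].
  by rewrite lte_fin divr_gt0 ?mulr_gt0 ?dist_gt0 //; apply/eqP.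
- move=> x y; rewrite /inversion; case: eqVneq => // _.
  by case: ifPn => // /orP[] /eqP-> _; [left|right]; exact: inversion_remote.
- by move=> w1 w2 /remoteP-> /remoteP->.
Qed.

(** The value 1 of [m] at [w] matches the convention of [dist]; inversion thus rescales by one
    factor per point, and these factors cancel in cross-ratios. *)
Lemma dist_inversion d w x y : semi_metric d -> x <> y ->
  let m z := if z == w then 1 else dist d z w in
  dist (inversion d w) x y = dist d x y / (m x * m y).
Proof.
move=> sd xy; have [] : (dist (inversion d w) x y = 1 /\ (x = w \/ y = w)) \/
    [/\ x <> w, y <> w &
     dist (inversion d w) x y = dist d x y / (dist d x w * dist d y w)].
  rewrite [dist (inversion _ _) _ _]/dist.
  have [xw|/eqP xw] := eqVneq x w.
    have yw : y <> w by move=> yw; apply: xy; rewrite xw yw.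
    left; split; last by left.
    by rewrite xw (semi_metric_sym (inversion_semi_metric w sd)) inversion_remote.
  have [yw|/eqP yw] := eqVneq y w.
    by left; split; [rewrite yw inversion_remote | right].
  by right; rewrite inversion_fin.
- move=> [-> []] e /=; rewrite e eqxx ?mul1r ?mulr1.
    rewrite ifN; last by apply/eqP => yw; apply: xy; rewrite e yw.
    by rewrite dist_sym // divff // gt_eqF // dist_gt0 // => yw; apply: xy; rewrite e yw.
  rewrite ifN; last by apply/eqP => xw; apply: xy; rewrite e xw.
  by rewrite divff // gt_eqF // dist_gt0 // => xw; apply: xy; rewrite e xw.
- by move=> [/eqP/negbTE xw /eqP/negbTE yw ->] /=; rewrite xw yw.
Qed.

Lemma inversion_equiv d w : semi_metric d -> moebius_equiv d (inversion d w).
Proof.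
move=> sd x1 x2 x3 x4 /=; rewrite !inE !negb_or -!andbA.
move=> /and4P[/eqP n12 /eqP n13 /eqP n14 /and4P[/eqP n23 /eqP n24 /eqP n34 _]].
rewrite /cross_ratio !dist_inversion //.
have m0 z : (if z == w then 1 else dist d z w) != 0.
  case: (eqVneq z w) => [_|/eqP zw]; first exact: oner_neq0.
  by rewrite gt_eqF // dist_gt0.
have p14 := dist_gt0 sd n14; have p23 := dist_gt0 sd n23.
by field; rewrite !m0 !gt_eqF.
Qed.

End SemiMetric.

Section MonotoneMoebius.
Variables (R : realType) (M : set (S1 R -> S1 R -> \bar R)).
Hypotheses (moebM : moebius_structure M) (monoM : monotone_moebius M).
Hypothesis incrM : increment_axiom M.
Variable d : S1 R -> S1 R -> \bar R.
Hypothesis Md : M d.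
Local Notation X := (S1 R).
Local Notation cp := (@circle_point R).
Local Notation D := (dist d).

Let sd : semi_metric d.
Proof. by case: moebM Md => d0 _ -> []. Qed.

Let D_pos x y : x <> y -> D x y \is Num.pos.
Proof. by move=> xy; rewrite posrE dist_gt0. Qed.

Lemma inversion_mem w : M (inversion d w).
Proof.
case: moebM Md => d0 sd0 -> [_ d0d]; split; first exact: inversion_semi_metric.
by move=> x1 x2 x3 x4 u; rewrite d0d //; exact: inversion_equiv.
Qed.

(** This is where (T) enters: balls of inverted semi-metrics belong to the subbase of the
    $M$-topology. *)
Lemma inversion_ball_open w x r : x <> w -> 0 < r ->
  open [set y | (inversion d w x y < r%:E)%E].
Proof.
move=> xw r0; apply/monoM.1; exists [set [set y | (inversion d w x y < r%:E)%E]].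
  move=> _ ->; apply: (@finI_from1 _ _ (moebius_balls M) id).
  exists (inversion d w), w, x, r; split=> //; first exact: inversion_mem.
  exact: inversion_remote.
by rewrite bigcup_set1.
Qed.

(** * The logarithmic distance of a monotone Möbius structure *)

Definition logd (s t : R) : R := ln (D (cp s) (cp t)).

Lemma logd_lt (s1 s2 s3 s4 t1 t2 t3 t4 : R) :
  cp s1 <> cp s2 -> cp s3 <> cp s4 -> cp t1 <> cp t2 -> cp t3 <> cp t4 ->
  (logd s1 s2 + logd s3 s4 < logd t1 t2 + logd t3 t4) =
  (D (cp s1) (cp s2) * D (cp s3) (cp s4) < D (cp t1) (cp t2) * D (cp t3) (cp t4)).
Proof.
move=> n1 n2 n3 n4; rewrite -!lnM ?D_pos // ltr_ln // posrE mulr_gt0 //;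
  exact: dist_gt0.
Qed.

Lemma logd_eq (s1 s2 s3 s4 t1 t2 t3 t4 : R) :
  cp s1 <> cp s2 -> cp s3 <> cp s4 -> cp t1 <> cp t2 -> cp t3 <> cp t4 ->
  logd s1 s2 + logd s3 s4 = logd t1 t2 + logd t3 t4 <->
  D (cp s1) (cp s2) * D (cp s3) (cp s4) = D (cp t1) (cp t2) * D (cp t3) (cp t4).
Proof.
move=> n1 n2 n3 n4; rewrite -!lnM ?D_pos //; split=> [|-> //].
by apply: ln_inj; rewrite posrE mulr_gt0 //; exact: dist_gt0.
Qed.

(** If [r] were omitted, the segment would be covered by two disjoint open sets: a ball about [p]
    with [q] remote, where the difference is below [r], and a ball about [q] with [p] remote, where
    it is above. *)
Lemma logd_surj p q r : p < q -> q < p + 2 * pi ->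
  exists s, [/\ p < s, s < q & logd s p - logd s q = r].
Proof.
move=> pq qp; apply: contrapT => none.
have npq := circle_point_neq pq qp.
have nqp : cp q <> cp p by move=> e; apply: npq.
have Dpq : 0 < D (cp p) (cp q) by exact: dist_gt0.
(* The radii absorb the constant factor [D (cp p) (cp q)] of the inversion formula. *)
have [rho1 rho2] : 0 < expR r / D (cp p) (cp q) /\ 0 < expR (- r) / D (cp p) (cp q).
  by split; rewrite divr_gt0 ?expR_gt0.
have open_pre B : open B -> open (cp @^-1` B).
  by move: B; apply/continuousP; exact: circle_point_continuous.
have := open_pre _ (inversion_ball_open npq rho1).
have := open_pre _ (inversion_ball_open nqp rho2).
set O2 := cp @^-1` _; set O1 := cp @^-1` _ => oO2 oO1.
have O1p : O1 p by rewrite /O1 /= /inversion eqxx lte_fin.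
have O2q : O2 q by rewrite /O2 /= /inversion eqxx lte_fin.
have nO1q : ~ O1 q.
  by rewrite /O1 /= /inversion; move/eqP/negbTE: npq => ->; rewrite eqxx orbT.
have nO2p : ~ O2 p.
  by rewrite /O2 /= /inversion; move/eqP/negbTE: nqp => ->; rewrite eqxx orbT.
have inO s : p < s -> s < q ->
    (O1 s <-> logd s p - logd s q < r) /\ (O2 s <-> r < logd s p - logd s q).
  move=> ps sq; have nsp : cp p <> cp s by apply: circle_point_neq => //; lra.
  have nsq : cp s <> cp q by apply: circle_point_neq => //; lra.
  have nsp' : cp s <> cp p by move=> e; apply: nsp.
  have nsq' : cp q <> cp s by move=> e; apply: nsq.
  have [Dsp Dsq] : 0 < D (cp s) (cp p) /\ 0 < D (cp s) (cp q).
    by split; exact: dist_gt0.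
  rewrite /O1 /O2 /= !inversion_fin // !lte_fin /logd -ln_div ?D_pos //.
  rewrite (dist_sym (cp q) (cp p) sd) (dist_sym _ (cp s) sd) (dist_sym (cp q) (cp s) sd).
  set A := D (cp s) (cp p) in Dsp *; set B := D (cp s) (cp q) in Dsq *.
  set C := D (cp p) (cp q) in Dpq *.
  have lnE : r = ln (expR r) by rewrite expRK.
  split.
    rewrite invfM mulrCA mulrC ltr_pM2r ?invr_gt0 // [in X in _ <-> X]lnE.
    by rewrite ltr_ln ?posrE ?expR_gt0 ?divr_gt0.
  rewrite invfM mulrCA mulrC ltr_pM2r ?invr_gt0 // [in X in _ <-> X]lnE.
  rewrite ltr_ln ?posrE ?expR_gt0 ?divr_gt0 // expRN.
  by rewrite -[B / A]invf_div ltf_pV2 ?posrE ?expR_gt0 ?divr_gt0.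
have O12 s : p <= s <= q -> (O1 s <-> ~ O2 s).
  move=> /andP[]; rewrite le_eqVlt => /orP[/eqP<- _|ps]; first by tauto.
  rewrite le_eqVlt => /orP[/eqP->|sq]; first by tauto.
  have [-> ->] := inO s ps sq; split=> [h1 h2|/negP]; first by lra.
  rewrite -leNgt le_eqVlt => /orP[/eqP e|//]; exfalso; apply: none.
  by exists s.
(* On the segment, [O1] is open, closed as the complement of [O2], and contains [p], so it is
   everything; but it misses [q]. *)
have := @segment_connected R p q (`[p, q] `&` O1).
case/(_ _ _ _)/seteqP => [||| _ /(_ q)].
- by exists p; split=> //=; rewrite in_itv /= lexx ltW.
- by exists O1.
- exists (~` O2); first by rewrite closedC.
  by apply/seteqP; split=> s [] /=; rewrite in_itv /= => h1 h2; split=> //; apply/(O12 s h1).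
- by rewrite /= in_itv /= lexx ltW // => /(_ erefl) [].
Qed.

Lemma cyclic_orderP (s : seq R) :
  (sorted <%R s /\ last 0 s < head 0 s + 2 * pi) \/
  (sorted <%R (rev s) /\ last 0 (rev s) < head 0 (rev s) + 2 * pi) ->
  cyclic_order (map cp s).
Proof.
by case=> -[? ?]; [left | right; rewrite -map_rev]; exact: counterclockwise_points.
Qed.

Lemma logd_log_distance : log_distance (2 * pi) logd.
Proof.
split.
- by move=> s t; rewrite /logd (dist_sym _ _ sd).
- by move=> s t; rewrite /logd circle_pointD2pi.
- move=> s1 s2 s3 s4 h12 h23 h34 h41.
  have n12 : cp s1 <> cp s2 by apply: circle_point_neq => //; lra.
  have n13 : cp s1 <> cp s3 by apply: circle_point_neq => //; lra.
  have n14 : cp s1 <> cp s4 by apply: circle_point_neq => //; lra.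
  have n23 : cp s2 <> cp s3 by apply: circle_point_neq => //; lra.
  have n24 : cp s2 <> cp s4 by apply: circle_point_neq => //; lra.
  have n34 : cp s3 <> cp s4 by apply: circle_point_neq => //; lra.
  have := monoM.2 d _ _ _ _ Md (circle_point_separate h12 h23 h34 h41).
  by rewrite gt_max !logd_lt // (dist_sym (cp s3) (cp s2) sd) => /andP.
- move=> o w v w' o' u x h.
  have neq s t : (s < t /\ t < s + 2 * pi) \/ (t < s /\ s < t + 2 * pi) -> cp s <> cp t.
    move=> [[st ts]|[ts st]]; first exact: circle_point_neq.
    by apply/nesym/circle_point_neq.
  have nou : cp o <> cp u by apply: neq; lra.
  have nov : cp o <> cp v by apply: neq; lra.
  have nox : cp o <> cp x by apply: neq; lra.
  have nvo' : cp v <> cp o' by apply: neq; lra.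
  have nvw' : cp v <> cp w' by apply: neq; lra.
  have no'u : cp o' <> cp u by apply: neq; lra.
  have no'x : cp o' <> cp x by apply: neq; lra.
  have nwu : cp w <> cp u by apply: neq; lra.
  have nwv : cp w <> cp v by apply: neq; lra.
  have nwx : cp w <> cp x by apply: neq; lra.
  have nw'u : cp w' <> cp u by apply: neq; lra.
  have nw'x : cp w' <> cp x by apply: neq; lra.
  rewrite !logd_eq // => e1 e2.
  have co : cyclic_order [:: cp o; cp w; cp v; cp w'; cp o'; cp u; cp x].
    apply: (@cyclic_orderP [:: o; w; v; w'; o'; u; x]).
    by case: h => h; [left|right]; rewrite /rev /=; split; lra.
  have := incrM Md co e1 e2.
  rewrite -ltr_ln ?posrE ?divr_gt0 ?mulr_gt0 ?dist_gt0 //.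
  rewrite !ln_div ?posrE ?mulr_gt0 ?dist_gt0 // !lnM ?posrE ?dist_gt0 //.
  by rewrite /logd => ?; lra.
- exact: logd_surj.
Qed.

End MonotoneMoebius.

(** * The time inequality *)

Lemma set2_inj (T : Type) (x y x' y' : T) : [set x; y] = [set x'; y'] ->
  (x = x' /\ y = y') \/ (x = y' /\ y = x').
Proof.
move=> e; have mem z : (z = x \/ z = y) <-> (z = x' \/ z = y').
  by change ([set x; y] z <-> [set x'; y'] z); rewrite e.
have [hx hy] := ((mem x).1 (or_introl erefl), (mem y).1 (or_intror erefl)).
have [hx' hy'] := ((mem x').2 (or_introl erefl), (mem y').2 (or_intror erefl)).
by case: hx hy hx' hy' => -> [] -> [] ? [] ?; intuition congruence.
Qed.

Section Time.
Variables (R : realType) (M : set (S1 R -> S1 R -> \bar R)).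
Hypotheses (moebM : moebius_structure M) (monoM : monotone_moebius M).
Hypothesis incrM : increment_axiom M.
Variable d : S1 R -> S1 R -> \bar R.
Hypothesis Md : M d.
Local Notation X := (S1 R).
Local Notation cp := (@circle_point R).
Local Notation D := (dist d).
Local Notation l := (logd d).

Let sd : semi_metric d.
Proof. by case: moebM Md => d0 _ -> []. Qed.

Let ld : log_distance (2 * pi) l := logd_log_distance moebM monoM incrM Md.

Let D_pos x y : x <> y -> D x y \is Num.pos.
Proof. by move=> xy; rewrite posrE dist_gt0. Qed.

(** The equation is symmetric under exchanging [x], [y] and under exchanging [z], [u], so the labels
    chosen by the definition do not matter. *)
Lemma timelike_lineP (x y z u : X) :
  timelike_line d [set z; u] [set x; y] <->
  uniq [:: x; y; z; u] /\ D x z * D y u = D x u * D y z.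
Proof.
split=> [[x' [y' [z' [u' [exy ezu + eD]]]]]|[un eD]]; last by exists x, y, z, u.
rewrite /= !inE !negb_or -!andbA => /and4P[n12 n13 n14 /and4P[n23 n24 n34 _]].
by case: (set2_inj exy) => -[-> ->]; case: (set2_inj ezu) => -[-> ->];
  rewrite ?(eq_sym y' x') ?(eq_sym u' z') n12 n13 n14 n23 n24 n34; split=> //; lra.
Qed.

Lemma timelike_perp a1 a2 u v :
  timelike_line d [set cp u; cp v] [set cp a1; cp a2] <->
  uniq [:: cp a1; cp a2; cp u; cp v] /\ perp l u v a1 a2.
Proof.
suff eqv : uniq [:: cp a1; cp a2; cp u; cp v] -> perp l u v a1 a2 <->
    D (cp a1) (cp u) * D (cp a2) (cp v) = D (cp a1) (cp v) * D (cp a2) (cp u).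
  by rewrite timelike_lineP; split=> -[un e]; split=> //; apply/(eqv un).
rewrite /= !inE !negb_or -!andbA => /and4P[_ /eqP n13 /eqP n14].
move=> /and4P[/eqP n23 /eqP n24 _ _]; rewrite -(logd_eq moebM Md) //.
rewrite /perp (logd_sym ld u a1) (logd_sym ld v a2) (logd_sym ld u a2).
by rewrite (logd_sym ld v a1) (addrC (l a2 u)).
Qed.

Lemma perp_timelike a1 a2 u v : a1 < u -> u < a2 -> a2 < v -> v < a1 + 2 * pi ->
  perp l u v a1 a2 -> timelike_line d [set cp u; cp v] [set cp a1; cp a2].
Proof.
move=> a1u ua2 a2v va1 puv; apply/timelike_perp; split=> //.
have n12 : cp a1 <> cp a2 by apply: circle_point_neq; lra.
have n13 : cp a1 <> cp u by apply: circle_point_neq; lra.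
have n14 : cp a1 <> cp v by apply: circle_point_neq; lra.
have n32 : cp u <> cp a2 by apply: circle_point_neq; lra.
have n24 : cp a2 <> cp v by apply: circle_point_neq; lra.
have n34 : cp u <> cp v by apply: circle_point_neq; lra.
rewrite /= !inE !negb_or (eq_sym (cp a2) (cp u)).
by move/eqP: n12 => ->; move/eqP: n13 => ->; move/eqP: n14 => ->;
  move/eqP: n32 => ->; move/eqP: n24 => ->; move/eqP: n34 => ->.
Qed.

(** * Computing and bounding the time *)

Lemma time_sym (a b : set X) : time d a b = time d b a.
Proof.
rewrite /time setIC; case: ifP => // _; congr xget.
suff sub a' b' : [set t | exists x y z z' : X,
      [/\ timelike_line d [set x; y] a', timelike_line d [set x; y] b', a' z, b' z' &
      t = `|ln ((D x z' * D y z) / (D x z * D y z'))|]] `<=`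
    [set t | exists x y z z' : X,
      [/\ timelike_line d [set x; y] b', timelike_line d [set x; y] a', b' z, a' z' &
      t = `|ln ((D x z' * D y z) / (D x z * D y z'))|]].
  by apply/seteqP; split; apply: sub.
move=> _ [x [y [z [z' [ta tb az bz' ->]]]]]; exists y, x, z', z; split=> //.
- by rewrite setUC.
- by rewrite setUC.
- by rewrite (mulrC (D y z)) (mulrC (D y z')).
Qed.

Lemma time_shared (a b : set X) : (exists x, a x /\ b x) -> time d a b = 0.
Proof.
move=> [x abx]; rewrite /time ifT //.
by apply/eqP => ab0; have : set0 x by rewrite -ab0.
Qed.

(* The perpendicular is not assumed unique: uniqueness of the value of the time
   comes from the minimality of the gap of the potential. *)
Lemma time_perp a1 a2 b1 b2 u v :
  b1 < a1 -> a1 < a2 -> a2 < b2 -> b2 < b1 + 2 * pi ->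
  a1 < u -> u < a2 -> b2 < v -> v < b1 + 2 * pi ->
  perp l u v a1 a2 -> perp l u v b1 b2 ->
  time d [set cp a1; cp a2] [set cp b1; cp b2] =
  (potential l a1 a2 b1 b2 u - potential l a1 a2 b1 b2 v) / 2.
Proof.
move=> b1a1 a1a2 a2b2 b2b1 a1u ua2 b2v vb1 pa pb.
have n11 : cp b1 <> cp a1 by apply: circle_point_neq; lra.
have n12 : cp b1 <> cp a2 by apply: circle_point_neq; lra.
have n21 : cp a1 <> cp b2 by apply: circle_point_neq; lra.
have n22 : cp a2 <> cp b2 by apply: circle_point_neq; lra.
have disj : [set cp a1; cp a2] `&` [set cp b1; cp b2] = set0.
  by rewrite -subset0 => x [[]-> []] // /esym.
rewrite /time disj eqxx /=; apply: xget_unique.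
  exists (cp u), (cp v), (cp a1), (cp b1).
  have ta : timelike_line d [set cp u; cp v] [set cp a1; cp a2].
    by apply: perp_timelike => //; lra.
  have tb : timelike_line d [set cp u; cp v] [set cp b1; cp b2].
    by apply: perp_timelike => //; lra.
  split=> //; [by left | by left|].
  have nub : cp b1 <> cp u by apply: circle_point_neq; lra.
  have nua : cp a1 <> cp u by apply: circle_point_neq; lra.
  have nvb : cp b1 <> cp v by apply: circle_point_neq; lra.
  have nva : cp a1 <> cp v by apply: circle_point_neq; lra.
  rewrite (dist_sym (cp u) _ sd) (dist_sym (cp v) _ sd) (dist_sym (cp u) _ sd)
    (dist_sym (cp v) _ sd).
  rewrite ln_div ?posrE ?mulr_gt0 ?dist_gt0 // !lnM ?D_pos //.
  have := @perp_value _ l a1 a2 b1 b2 u v a1 b1 pa pb (or_introl erefl) (or_introl erefl).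
  have := @potential_gt _ _ _ ld a1 a2 b1 b2 u v ltac:(lra) ltac:(lra) b2b1
    ltac:(left; lra) a1u ua2 b2v vb1.
  rewrite (logd_sym ld u) (logd_sym ld v) (logd_sym ld u) (logd_sym ld v) /logd.
  by move=> h1 h2; rewrite ger0_norm; lra.
(* Any other admissible event gives the same value: its points are lifted to the window starting at
   [b1], where [perp_localized] places them. *)
move=> _ [x [y [z [z' [ta tb az bz ->]]]]].
have [s [b1s sb1 xs]] := circle_point_surj x b1.
have [t [b1t tb1 yt]] := circle_point_surj y b1.
move: ta tb; rewrite xs yt => /timelike_perp[una pa'] /timelike_perp[unb pb'].
have [p [zp hp]] : exists p, z = cp p /\ (p = a1 \/ p = a2).
  by case: az => ->; [exists a1|exists a2]; split=> //; [left|right].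
have [q [zq hq]] : exists q, z' = cp q /\ (q = b1 \/ q = b2).
  by case: bz => ->; [exists b1|exists b2]; split=> //; [left|right].
move: una; rewrite /= !inE !negb_or -!andbA.
move=> /and4P[_ /eqP na1s /eqP na1t /and4P[/eqP na2s /eqP na2t /eqP nst _]].
move: unb; rewrite /= !inE !negb_or -!andbA.
move=> /and4P[_ /eqP nb1s /eqP nb1t /and4P[/eqP nb2s /eqP nb2t _ _]].
have lt_b1 r : b1 <= r -> cp b1 <> cp r -> b1 < r.
  by rewrite le_eqVlt => /orP[/eqP<-|].
have neq r r' : cp r <> cp r' -> r' <> r by move=> h pq; apply: h; rewrite pq.
have [nps nqs npt nqt] : [/\ cp s <> cp p, cp s <> cp q, cp t <> cp p & cp t <> cp q].
  by split; apply/nesym; (case: hp => -> || case: hq => ->).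
rewrite zp zq ln_div ?posrE ?mulr_gt0 ?dist_gt0 // !lnM ?D_pos //.
have loc := @perp_localized _ _ _ ld a1 a2 b1 b2 s t b1a1 a1a2 a2b2 b2b1
  (lt_b1 _ b1s nb1s) sb1 (neq _ _ na1s) (neq _ _ na2s) (neq _ _ nb2s)
  (lt_b1 _ b1t nb1t) tb1 (neq _ _ na1t) (neq _ _ na2t) (neq _ _ nb2t)
  (fun e => neq _ _ nst (esym e)) pa' pb'.
(* Both pairs minimise the gap, so each gap is at most the other. *)
have gap_eq s' t' : a1 < s' -> s' < a2 -> b2 < t' -> t' < b1 + 2 * pi ->
    perp l s' t' a1 a2 -> perp l s' t' b1 b2 ->
    `|l s' q + l t' p - (l s' p + l t' q)| =
    (potential l a1 a2 b1 b2 u - potential l a1 a2 b1 b2 v) / 2.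
  move=> a1s' s'a2 b2t' t'b1 ps pt.
  have [min1 _] := @potential_gap_min _ _ _ ld a1 a2 b1 b2 u v s' t' b1a1 a2b2 b2b1
    a1u ua2 b2v vb1 pa pb a1s' s'a2 b2t' t'b1.
  have [min2 _] := @potential_gap_min _ _ _ ld a1 a2 b1 b2 s' t' u v b1a1 a2b2 b2b1
    a1s' s'a2 b2t' t'b1 ps pt a1u ua2 b2v vb1.
  have val := @perp_value _ l a1 a2 b1 b2 s' t' p q ps pt hp hq.
  have := @potential_gt _ _ _ ld a1 a2 b1 b2 u v ltac:(lra) ltac:(lra) b2b1
    ltac:(left; lra) a1u ua2 b2v vb1.
  by move=> h1; rewrite ger0_norm; lra.
case: loc => -[h1 h2 h3 h4]; first by rewrite -(gap_eq s t).
(* If [y] is the point behind [a], the ends change places, which only flips the sign inside the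
   absolute value. *)
rewrite -(gap_eq t s) //; [|exact: perp_sym..].
by rewrite distrC (addrC (l t q)) (addrC (l t p)).
Qed.

(** For disjoint events the time is the gap at a common perpendicular, the strict minimum. For
    events sharing a point the time is 0, the gap is positive and no [(u, v)] is perpendicular to
    both, so the equivalence persists. *)
Lemma time_le a1 a2 b1 b2 u v :
  b1 <= a1 -> a1 < a2 -> a2 <= b2 -> b2 < b1 + 2 * pi -> a1 <> b1 \/ a2 <> b2 ->
  a1 < u -> u < a2 -> b2 < v -> v < b1 + 2 * pi ->
  let gap := (potential l a1 a2 b1 b2 u - potential l a1 a2 b1 b2 v) / 2 in
  let t := time d [set cp a1; cp a2] [set cp b1; cp b2] in
  t <= gap /\ (t = gap <-> perp l u v a1 a2 /\ perp l u v b1 b2).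
Proof.
move=> b1a1 a1a2 a2b2 b2b1 ne a1u ua2 b2v vb1 gap t.
have gap0 : 0 < gap.
  have := @potential_gt _ _ _ ld a1 a2 b1 b2 u v b1a1 a2b2 b2b1 ne a1u ua2 b2v vb1.
  by rewrite /gap => ?; lra.
have degenerate : t = 0 -> ~ (perp l u v a1 a2 /\ perp l u v b1 b2) ->
    t <= gap /\ (t = gap <-> perp l u v a1 a2 /\ perp l u v b1 b2).
  by move=> -> np; split; [exact: ltW | split=> [e|//]; move: gap0; rewrite -e ltxx].
have [e1|/eqP n1] := eqVneq a1 b1.
  apply: degenerate; first by apply: time_shared; exists (cp a1); rewrite -e1; split; left.
  (* Subtracting the two perpendicularity equations leaves an equality for [u], [a2], [b2], [v] that
     contradicts (M). *)
  rewrite /perp e1 => -[pa pb]; case: ne => // /eqP ne2.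
  have lt2 : a2 < b2 by rewrite lt_neqAle ne2.
  have [+ _] := @logd_cross _ _ _ ld u a2 b2 v ltac:(lra) ltac:(lra) ltac:(lra) ltac:(lra).
  by rewrite (logd_sym ld b2 v) (logd_sym ld a2 v) => ?; lra.
have lt1 : b1 < a1 by rewrite lt_neqAle b1a1 eq_sym andbT; exact/eqP.
have [e2|/eqP n2] := eqVneq a2 b2.
  apply: degenerate; first by apply: time_shared; exists (cp a2); rewrite e2; split; right.
  rewrite /perp e2 => -[pa pb].
  have [_] := @logd_cross _ _ _ ld b1 a1 u v ltac:(lra) ltac:(lra) ltac:(lra) ltac:(lra).
  rewrite (logd_sym ld b1) (logd_sym ld a1) (logd_sym ld b1 u) (logd_sym ld a1 v).
  by move=> ?; lra.
have lt2 : a2 < b2 by rewrite lt_neqAle a2b2 andbT; exact/eqP.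
have [u0 [v0 [a1u0 u0a2 b2v0 v0b1 [pa0 pb0]]]] := perp_exists ld lt1 a1a2 lt2 b2b1.
have tE := time_perp lt1 a1a2 lt2 b2b1 a1u0 u0a2 b2v0 v0b1 pa0 pb0.
have [le_gap eq_gap] := potential_gap_min ld lt1 lt2 b2b1 a1u0 u0a2 b2v0 v0b1 pa0 pb0
  a1u ua2 b2v vb1.
rewrite -/t in tE; split; first by rewrite tE /gap; lra.
split=> [e|[pa pb]]; last by rewrite /t (time_perp lt1 a1a2 lt2 b2b1 a1u ua2 b2v vb1).
by have [|-> ->] := eq_gap; first by rewrite /gap tE in e; lra.
Qed.

End Time.

Theorem corollary7p12 (R : realType) (M : set (S1 R -> S1 R -> \bar R)) :
  moebius_structure M -> monotone_moebius M -> increment_axiom M ->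
  forall d : S1 R -> S1 R -> \bar R, M d ->
  forall a b c : set (S1 R), event a -> event b -> event c -> before a b c ->
    time d a b + time d b c <= time d a c /\
    (0 < time d a c ->
      (time d a b + time d b c = time d a c <->
       exists e : set (S1 R), [/\ event e, timelike_line d e a,
         timelike_line d e b & timelike_line d e c])).
Proof.
move=> moebM monoM incrM d Md a b c ea eb ec abc.
have ld := logd_log_distance moebM monoM incrM Md.
have [nab nbc] : a <> b /\ b <> c by case: abc.
have [b1 [a1 [a2 [b2 [c1 [c2 [[b1a1 a1a2 a2b2] [b2c1 c1c2 c2b1] [ea' eb' ec']]]]]]]] :=
  before_angles ea eb ec abc.
have b2b1 : b2 < b1 + 2 * pi by lra.
have period s : logd d (s + 2 * pi) = logd d s.
  by apply/funext => t; rewrite (logd_period ld).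
have period_r s t : logd d s (t + 2 * pi) = logd d s t by rewrite (logd_period_r ld).
have nab12 : a1 <> b1 \/ a2 <> b2.
  have [e1|/eqP] := eqVneq a1 b1; [right=> e2 | by left].
  by apply: nab; rewrite ea' eb' e1 e2.
have nbc12 : c1 <> b2 \/ c2 <> b1 + 2 * pi.
  have [e1|/eqP] := eqVneq c1 b2; [right=> e2 | by left].
  by apply: nbc; rewrite eb' ec' e1 e2 circle_pair_rot.
have time_ab := time_le moebM monoM incrM Md b1a1 a1a2 a2b2 b2b1 nab12.
(* Seen from [c], the event [b] runs from [b2] to [b1 + 2 * pi], and [c] lies inside this arc. *)
have b1b2 : b1 + 2 * pi < b2 + 2 * pi by lra.
have time_cb u v := time_le moebM monoM incrM Md b2c1 c1c2 c2b1 b1b2 nbc12 (u:=u) (v:=v).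
(* A point common to [a] and [c] has to be an end of [b]; then all three times vanish. *)
have [[x [ax cx]]|disj] := pselect (exists x, a x /\ c x).
  have bx : b x.
    have [s [xs a1s sa2]] : exists s, [/\ x = circle_point s, a1 <= s & s <= a2].
      by move: ax; rewrite ea' => -[]->; [exists a1|exists a2]; split=> //; lra.
    have [t [xt c1t tc2]] : exists t, [/\ x = circle_point t, c1 <= t & t <= c2].
      by move: cx; rewrite ec' => -[]->; [exists c1|exists c2]; split=> //; lra.
    have [st|st] := eqVneq s t.
      by rewrite eb'; right; rewrite xs; congr circle_point; lra.
    have [ts|ts] := eqVneq t (s + 2 * pi).
      by rewrite eb'; left; rewrite xs; congr circle_point; lra.
    have lt_st : s < t by rewrite lt_neqAle st; lra.
    have lt_ts : t < s + 2 * pi by rewrite lt_neqAle ts; lra.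
    by case: (circle_point_neq lt_st lt_ts); rewrite -xs -xt.
  by rewrite !time_shared ?addr0 ?ltxx //; exists x.
have a2c1 : a2 < c1.
  rewrite lt_neqAle (le_trans a2b2 b2c1) andbT; apply/eqP => e; apply: disj.
  by exists (circle_point a2); rewrite ea' ec' -e; split; [right|left].
have c2a1 : c2 - 2 * pi < a1.
  rewrite lt_neqAle; apply/andP; split; last by lra.
  apply/eqP => e; apply: disj; exists (circle_point a1); rewrite ea' ec'; split; first by left.
  by right; rewrite -e -(circle_pointD2pi (c2 - 2 * pi)) subrK.
have c1c2' : c1 < c2 - 2 * pi + 2 * pi by rewrite subrK.
(* For comparison with [a], the event [c] is written as the outer pair [c2 - 2 * pi], [c1], whose
   arc contains [a]. *)
have ec'' : c = [set circle_point (c2 - 2 * pi); circle_point c1].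
  by rewrite ec' (circle_pair_rot (c2 - 2 * pi)) subrK.
have per_c2 s : logd d s (c2 - 2 * pi) = logd d s c2.
  by rewrite -(period_r s (c2 - 2 * pi)) subrK.
have nac12 : a1 <> c2 - 2 * pi \/ a2 <> c1 by left; apply/eqP; rewrite gt_eqF.
have time_ac u v :=
  time_le moebM monoM incrM Md (ltW c2a1) a1a2 (ltW a2c1) c1c2' nac12 (u:=u) (v:=v).
(* [g1] and [g2] are the half gaps of [a, b] and of [c, b]. For the latter the roles are reversed:
   [v] is behind [c] and [u + 2 * pi] behind [b]. In the sum the terms of [b] cancel, which leaves
   the half gap of [a, c]. *)
have key u v : a1 < u -> u < a2 -> c1 < v -> v < c2 -> exists g1 g2,
    [/\ time d a b <= g1, time d b c <= g2,
      time d a b = g1 <-> perp (logd d) u v a1 a2 /\ perp (logd d) u v b1 b2,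
      time d b c = g2 <-> perp (logd d) u v c1 c2 /\ perp (logd d) u v b1 b2 &
      time d a c = g1 + g2 <-> perp (logd d) u v a1 a2 /\ perp (logd d) u v c1 c2].
  move=> a1u ua2 c1v vc2.
  have := time_ab u v a1u ua2 ltac:(lra) ltac:(lra); rewrite -ea' -eb' => -[le_ab eq_ab].
  have := time_cb v (u + 2 * pi) c1v vc2 ltac:(lra) ltac:(lra).
  rewrite -ec' -circle_pair_rot -eb' time_sym => -[le_cb eq_cb].
  have := time_ac u v a1u ua2 c1v ltac:(lra); rewrite -ea' -ec'' => -[_ eq_ac].
  eexists; eexists; split; [exact: le_ab | exact: le_cb | exact: eq_ab | |].
    rewrite eq_cb /perp !period_r !period; split=> -[]; lra.
  rewrite -[X in _ = X](_ : (potential (logd d) a1 a2 (c2 - 2 * pi) c1 u -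
      potential (logd d) a1 a2 (c2 - 2 * pi) c1 v) / 2 = _).
    by rewrite eq_ac /perp !per_c2; split=> -[]; lra.
  by rewrite /potential !per_c2 !period !period_r; lra.
have shift_c u v : perp (logd d) u v (c2 - 2 * pi) c1 <-> perp (logd d) u v c1 c2.
  by rewrite /perp per_c2 per_c2; split; lra.
(* At the common perpendicular of [a] and [c] the time of [a, c] equals its half gap, and the other
   two times are bounded by theirs. *)
have [u0 [v0 [a1u ua2 c1v vc2 [pa /shift_c pc]]]] := perp_exists ld c2a1 a1a2 a2c1 c1c2'.
have [g1 [g2 [le_ab le_bc eq_ab eq_bc eq_ac]]] := key u0 v0 a1u ua2 c1v ltac:(lra).
have tac := eq_ac.2 (conj pa pc).
split; first by rewrite tac lerD.
move=> _; split=> [eq_abc|[e [[x [y [_ ->]]] ta tb tc]]].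
  (* The sum of the two bounds is attained, so each is, and [(u0, v0)] is perpendicular to [b]. *)
  have /eq_ab[_ pb] : time d a b = g1 by lra.
  exists [set circle_point u0; circle_point v0]; split.
  - exists (circle_point u0), (circle_point v0); split=> //.
    have [uv vu] : u0 < v0 /\ v0 < u0 + 2 * pi by split; lra.
    exact: circle_point_neq.
  - by rewrite ea'; apply: (perp_timelike moebM monoM incrM Md) => //; lra.
  - by rewrite eb'; apply: (perp_timelike moebM monoM incrM Md) => //; lra.
  - have [v0c2 c2u0 u0c1] : [/\ v0 < c2, c2 < u0 + 2 * pi & u0 + 2 * pi < c1 + 2 * pi].
      by split; lra.
    rewrite ec' setUC -(circle_pointD2pi u0).
    apply: (perp_timelike moebM monoM incrM Md) => //.
    by move: pc; rewrite /perp !period => ?; lra.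
have uniq_ne p q (e1 e2 : S1 R) : timelike_line d [set e1; e2]
    [set circle_point p; circle_point q] ->
    [/\ e1 <> circle_point p, e1 <> circle_point q, e2 <> circle_point p,
      e2 <> circle_point q & e1 <> e2].
  move=> /timelike_lineP[+ _]; rewrite /= !inE !negb_or -!andbA.
  move=> /and4P[_ /eqP n1 /eqP n2 /and4P[/eqP n3 /eqP n4 /eqP n5 _]].
  by split=> // h; [apply: n1|apply: n3|apply: n2|apply: n4].
(* The ends of [e] are lifted to the window starting at [c2 - 2 * pi]; localising them with respect
   to [a] and [c] makes [key] applicable, and there all three times equal their half gaps. *)
have [s [c2s sc2 xs]] := circle_point_surj x (c2 - 2 * pi).
have [t [c2t tc2 yt]] := circle_point_surj y (c2 - 2 * pi).
rewrite xs yt ea' in ta; rewrite xs yt eb' in tb; rewrite xs yt ec'' in tc.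
have [sa1 sa2 ta1 ta2 st] := uniq_ne _ _ _ _ ta.
have [sc1' sc1 tc1' tc1 _] := uniq_ne _ _ _ _ tc.
have [_ pa'] := (timelike_perp moebM monoM incrM Md _ _ _ _).1 ta.
have [_ pb'] := (timelike_perp moebM monoM incrM Md _ _ _ _).1 tb.
have [_ pc'] := (timelike_perp moebM monoM incrM Md _ _ _ _).1 tc.
have conclude s' t' : a1 < s' -> s' < a2 -> c1 < t' -> t' < c2 - 2 * pi + 2 * pi ->
    perp (logd d) s' t' a1 a2 -> perp (logd d) s' t' b1 b2 ->
    perp (logd d) s' t' (c2 - 2 * pi) c1 -> time d a b + time d b c = time d a c.
  move=> a1s s2a c1t t2c psa psb /shift_c psc.
  have [h1 [h2 [_ _ eab ebc eac]]] := key s' t' a1s s2a c1t ltac:(lra).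
  by rewrite (eab.2 (conj psa psb)) (ebc.2 (conj psc psb)) (eac.2 (conj psa psc)).
have neq (p q : R) : circle_point p <> circle_point q -> p <> q by move=> h pq; apply: h; rewrite pq.
have lt_c2 p : c2 - 2 * pi <= p -> circle_point p <> circle_point (c2 - 2 * pi) ->
    c2 - 2 * pi < p.
  by rewrite le_eqVlt => /orP[/eqP<-|].
have [[h1 h2 h3 h4]|[h1 h2 h3 h4]] := perp_localized ld c2a1 a1a2 a2c1 c1c2'
  (lt_c2 _ c2s sc1') sc2 (neq _ _ sa1) (neq _ _ sa2) (neq _ _ sc1)
  (lt_c2 _ c2t tc1') tc2 (neq _ _ ta1) (neq _ _ ta2) (neq _ _ tc1)
  (neq _ _ st) pa' pc'.
- exact: (conclude s t).
- by apply: (conclude t s) => //; exact: perp_sym.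
Qed.
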